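(* Let $\bar M={}_fI\times_\sigma M$ be a doubly warped spacetime with metric $\bar g=-f^2dt^2\oplus\sigma^2g$. A time-like vector field $\bar\zeta=h\partial_t$ is a conformal vector field on $\bar M$ if and only if $h=a\sigma$ where $a$ is a non-negative constant. Moreover, the conformal factor is $\rho=2\dot h$.
   Context: $(M,g)$ is a Riemannian manifold, $I$ is an open connected interval with metric $-dt^2$, and $f:M\to(0,\infty)$, $\sigma:I\to(0,\infty)$ are smooth. The doubly warped spacetime ${}_fI\times_\sigma M$ is the product $I\times M$ with the metric $\bar g=-f^2dt^2\oplus\sigma^2g$. Here $h:I\to\mathbb R$ is a smooth function of $t$, a dot denotes $d/dt$, and ''time-like'' refers to vector fields of the form $h\partial_t$ (no component along $M$; the case $h=0$ is allowed and corresponds to $a=0$). A vector field $\zeta$ on a pseudo-Riemannian manifold $(N,k)$ is conformal with conformal factor $\rho$ (a function on $N$) if $\mathcal L_\zeta k=\rho k$, where $\mathcal L_\zeta$ is the Lie derivative with respect to $\zeta$.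
   Formalization: For arbitrary h the constant a may be any real number (h = -σ is conformal with a = -1); a is shown non-negative when h ≥ 0 on I. M is taken non-empty of dimension at least 1, since otherwise every h∂_t is conformal. *)

(* Defs.v *)
From HB Require Import structures.
From mathcomp Require Import all_boot all_order all_algebra.
From mathcomp Require Import all_classical all_reals all_analysis.

Set Implicit Arguments.
Unset Strict Implicit.
Unset Printing Implicit Defensive.

Import Order.TTheory GRing.Theory Num.Theory.
Import numFieldNormedType.Exports.

Local Open Scope classical_set_scope.
Local Open Scope ring_scope.

(** Smooth manifolds, modelled on a normed space [E], with the tensor calculus
    carried out in the charts of an atlas.  The base is MathComp-Analysis. *)

Section Smooth.
Context {R : realType} {E F : normedModType R}.

(** [U] is meant to be open, and [E] finite-dimensional: [f] is C^(k+1) on [U]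
    when it is differentiable there and all its directional derivatives are
    C^k.  The values of [f] outside [U] are irrelevant. *)
Fixpoint Ck_on (k : nat) (U : set E) (f : E -> F) : Prop :=
  match k with
  | 0 => forall x, U x -> {for x, continuous f}
  | k'.+1 => (forall x, U x -> differentiable f x) /\
             forall v, Ck_on k' U ('D_v f)
  end.

Definition smooth_on (U : set E) (f : E -> F) := forall k, Ck_on k U f.

End Smooth.

Section Manifold.
Context {R : realType} {E : normedModType R}.

(** The underlying space is the subset [carrier] of the topological space
    [points]; functions on the manifold are total functions on [points] whose
    values outside [carrier] are irrelevant.  This lets an open interval have
    [R] itself as its type of points.  Likewise [coord i] and [param i], the
    [i]-th chart and its inverse, only matter on [dom i] and [cod i]. *)
Record atlas := Atlas {
  points : topologicalType;
  carrier : set points;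
  chart : Type;
  dom : chart -> set points;
  cod : chart -> set E;
  coord : chart -> points -> E;
  param : chart -> E -> points
}.

Arguments carrier : clear implicits.

Definition homeo_chart (M : atlas) (i : chart M) : Prop :=
  [/\ open (dom i), open (cod i),
      forall p, dom i p -> cod i (coord i p) /\ param i (coord i p) = p,
      forall x, cod i x -> dom i (param i x) /\ coord i (param i x) = x &
      (forall p, dom i p -> {for p, continuous (coord i)}) /\
      (forall x, cod i x -> {for x, continuous (param i)})].

Definition overlap (M : atlas) (i j : chart M) : set E :=
  [set x | cod i x /\ dom j (param i x)].

Definition transition (M : atlas) (i j : chart M) : E -> E :=
  fun x => coord j (param i x).

(** [carrier] is then an open set, being a union of chart domains. *)
Definition smooth_manifold (M : atlas) : Prop :=
  [/\ hausdorff_space (points M), @second_countable (points M),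
      carrier M = \bigcup_(i in [set: chart M]) dom i,
      forall i : chart M, homeo_chart i &
      forall i j : chart M, smooth_on (overlap i j) (transition i j)].

Definition smooth_fun (M : atlas) (f : points M -> R) : Prop :=
  forall i : chart M, smooth_on (cod i) (f \o param i).

(** Vector fields and covariant 2-tensor fields are given by their local
    representatives in the charts, subject to the transformation rule. *)
Definition vfield (M : atlas) := chart M -> E -> E.

Definition smooth_vfield (M : atlas) (X : vfield M) : Prop :=
  (forall i, smooth_on (cod i) (X i)) /\
  (forall (i j : chart M) x, overlap i j x ->
     X j (transition i j x) = 'd (transition i j) x (X i x)).

Definition tensor2 (M : atlas) := chart M -> E -> E -> E -> R.

Definition symmetric_bilinear (b : E -> E -> R) : Prop :=
  (forall u v, b u v = b v u) /\
  (forall (a : R) u u' v, b (a *: u + u') v = a * b u v + b u' v).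

Definition smooth_tensor2 (M : atlas) (k : tensor2 M) : Prop :=
  [/\ forall i x, cod i x -> symmetric_bilinear (k i x),
      forall i u v, smooth_on (cod i) (fun x => k i x u v) &
      forall (i j : chart M) x u v, overlap i j x ->
        k i x u v = k j (transition i j x) ('d (transition i j) x u)
                                           ('d (transition i j) x v)].

Definition riemannian_metric (M : atlas) (g : tensor2 M) : Prop :=
  smooth_tensor2 g /\
  forall i x, cod i x -> forall u, u != 0 -> 0 < g i x u u.

(** The bracket of two vector fields of an open subset of [E]. *)
Definition lie_bracket (X Y : E -> E) (x : E) : E :=
  'D_(X x) Y x - 'D_(Y x) X x.

(** (L_Z b)(X, Y) = Z(b(X, Y)) - b([Z, X], Y) - b(X, [Z, Y]), for vector fields
    X, Y, Z and a 2-tensor field b of an open subset of [E]. *)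
Definition lie_derivative (Z : E -> E) (b : E -> E -> E -> R)
    (X Y : E -> E) (x : E) : R :=
  'D_(Z x) (fun y => b y (X y) (Y y)) x
  - b x (lie_bracket Z X x) (Y x) - b x (X x) (lie_bracket Z Y x).

(** L_Z k = rho k, as an equality of tensor fields: on each chart domain, it is
    tested on all the vector fields of that domain. *)
Definition conformal_vfield (M : atlas) (k : tensor2 M) (Z : vfield M)
    (rho : points M -> R) : Prop :=
  smooth_vfield Z /\
  forall (i : chart M) (X Y : E -> E),
    smooth_on (cod i) X -> smooth_on (cod i) Y ->
    forall x, cod i x ->
      lie_derivative (Z i) (k i) X Y x
      = rho (param i x) * k i x (X x) (Y x).

End Manifold.

Arguments atlas {R} E.
Arguments carrier {R E} a _.

Section DoublyWarped.
Context {R : realType} {E : normedModType R}.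

(** The product of an open interval [I] with [M].  Its charts are id * phi for
    the charts phi of [M], hence its atlas is indexed by that of [M]. *)
Definition interval_product (I : set R) (M : atlas E) : atlas (R * E)%type :=
  {| points := (R * points M)%type;
     carrier := I `*` carrier M;
     chart := chart M;
     dom := fun i => I `*` dom i;
     cod := fun i => I `*` cod i;
     coord := fun i p => (p.1, coord i p.2);
     param := fun i x => (x.1, param i x.2) |}.

(** - f^2 dt^2 + sigma^2 g *)
Definition doubly_warped_metric (I : set R) (M : atlas E)
    (f : points M -> R) (sigma : R -> R) (g : tensor2 M) :
    tensor2 (interval_product I M) :=
  fun (i : chart M) x u v =>
    - (f (param i x.2) ^+ 2) * (u.1 * v.1) + sigma x.1 ^+ 2 * g i x.2 u.2 v.2.

(** h d/dt *)
Definition timelike_vfield (I : set R) (M : atlas E) (h : R -> R) :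
    vfield (interval_product I M) :=
  fun i x => (h x.1, 0).

End DoublyWarped.

(* Main.v *)
(** Only the t-derivative of the metric enters L_(h d/dt), and
    L_(h d/dt) (-f^2 dt^2 + sigma^2 g) = -2 h' f^2 dt^2 + 2 h sigma sigma' g.
    Evaluating the conformal equation on d/dt gives rho = 2 h'; evaluating it on
    a nonzero vector tangent to M then gives h sigma' = h' sigma, i.e.
    (h / sigma)' = 0 on the connected interval I. *)

Require Import Defs.
From HB Require Import structures.
From mathcomp Require Import all_boot all_order all_algebra.
From mathcomp Require Import all_classical all_reals all_analysis.
From mathcomp Require Import ring.
Import Order.TTheory GRing.Theory Num.Theory.
Import numFieldNormedType.Exports.
Local Open Scope classical_set_scope.
Local Open Scope ring_scope.

(** * Locality of differentiability and of the class C^k *)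

(** The first-order expansion of [f] at [x] is also one of [g], and uniqueness of the differential
    then identifies ['d g x] with ['d f x]. *)
Lemma near_eq_differentiable {R : numFieldType} {V W : normedModType R}
    {f g : V -> W} {x : V} :
  {near x, f =1 g} -> differentiable f x -> differentiable g x.
Proof.
move=> fg df; have fgx : f x = g x := nbhs_singleton fg.
have fgo : g \o shift x = cst (g x) + 'd f x +o_ 0 id.
  apply/eqaddoP => e e0; have /diff_locally/eqaddoP/(_ e e0) := df.
  apply: filterS2; last first.
    by have := fg; rewrite (near_shift 0); apply.
  by move=> y /=; rewrite subr0 /cst /= !fctE /= => <-; rewrite fgx.
have dfg := diff_unique (diff_continuous df) fgo.
apply/diff_locallyP; rewrite dfg; split => //; exact: diff_continuous df.
Qed.

(** As [U] is open, equality on [U] is equality near each of its points, so it passes to all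
    directional derivatives and the induction goes through. *)
Lemma eq_Ck_on {R : realType} {E F : normedModType R} {k : nat} {U : set E}
    {f g : E -> F} :
  open U -> (forall x, U x -> f x = g x) -> Ck_on k U f -> Ck_on k U g.
Proof.
move=> oU; elim: k f g => [|k IHk] f g fg.
  move=> fc x Ux; have nfg : {near x, f =1 g}.
    by apply: filterS (open_nbhs_nbhs (conj oU Ux)).
  have := fc x Ux; rewrite /prop_for /continuous_at (fg x Ux); apply: cvg_trans.
  exact: near_eq_cvg.
have nfg x : U x -> {near x, f =1 g}.
  by move=> Ux; apply: filterS (open_nbhs_nbhs (conj oU Ux)).
move=> [fd fD]; split=> [x Ux|v].
  exact: near_eq_differentiable (nfg x Ux) (fd x Ux).
by apply: IHk (fD v) => x Ux; apply: near_eq_derive; exact: nfg.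
Qed.

Lemma Ck_on_cst (R : realType) (E F : normedModType R) (k : nat) (U : set E)
    (a : F) : Ck_on k U (cst a).
Proof.
elim: k a => [|k IHk] a; first by move=> x _; exact: cst_continuous.
split=> // v; have -> : 'D_v (cst a : E -> F) = cst 0 by apply/funext => x; exact: derive_cst.
exact: IHk.
Qed.

(** * Derivatives through linear maps, projections and bilinear forms *)

Lemma is_derive_linear {R : numFieldType} {V W W' : normedModType R}
    {L : W -> W'} {f : V -> W} {x v : V} {df : W} :
  linear L -> continuous L -> is_derive x v f df ->
  is_derive x v (L \o f) (L df).
Proof.
move=> linL contL [dvf <-].
pose LL : {linear W -> W'} := HB.pack L (GRing.isLinear.Build _ _ _ _ L linL).
have : L = LL by [].
move: LL => {linL} LL LE; rewrite {}LE in contL *.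
have cvgL : (fun h => h^-1 *: ((LL \o f \o shift x) (h *: v) - (LL \o f) x)) @ 0^'
             --> LL ('D_v f x).
  rewrite [X in X @ _](_ : _ = LL \o (fun h => h^-1 *: ((f \o shift x) (h *: v) - f x))).
    have dvf1 : (fun h => h^-1 *: ((f \o shift x) (h *: v) - f x)) @ 0^' --> 'D_v f x := dvf.
    have cL : LL @ 'D_v f x --> LL ('D_v f x) := contL _.
    exact: cvg_comp dvf1 cL.
  by apply/funext => h /=; rewrite -linearB -linearZ.
by apply: DeriveDef; [exact: cvgP cvgL | exact: cvg_lim _ cvgL].
Qed.

Lemma is_derive_fst {R : realType} {E W : normedModType R} {s : R -> W}
    {x : R * E} (v : R * E) :
  derivable s x.1 1 -> is_derive x v (s \o fst) (v.1 *: 'D_1 s x.1).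
Proof.
move=> ds; have dfs : differentiable s x.1 by apply/derivable1_diffP.
apply: DeriveDef; first exact: (diff_derivable (v := v.1) dfs).
rewrite -[LHS]/('D_(v.1) s x.1) !deriveE//.
by rewrite -[in LHS](mulr1 v.1) linearZ.
Qed.

Lemma linear_fst (R : realType) (E : normedModType R) : linear (fst : R * E -> R).
Proof. by []. Qed.

Lemma linear_snd (R : realType) (E : normedModType R) : linear (snd : R * E -> E).
Proof. by []. Qed.

Lemma linear_pair0 (R : realType) (E : normedModType R) :
  linear (fun r : R => (r, 0) : R * E).
Proof. by move=> a u v; congr pair; rewrite /= scaler0 addr0. Qed.

Lemma continuous_pair0 (R : realType) (E : normedModType R) :
  continuous (fun r : R => (r, 0) : R * E).
Proof. by move=> r; exact: (cvg_pair (f := id) (g := cst 0) (@cvg_id _ _) (cvg_cst _)). Qed.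

Lemma is_diff_linear {R : numFieldType} {V W : normedModType R} {L : V -> W}
    (x : V) :
  linear L -> continuous L -> is_diff x L L.
Proof.
move=> linL contL.
pose LL : {linear V -> W} := HB.pack L (GRing.isLinear.Build _ _ _ _ L linL).
by apply: DiffDef; [exact: (@linear_differentiable _ _ _ LL)
                   |exact: (@diff_lin _ _ _ LL)].
Qed.

Lemma continuous_fst (R : realType) (E : normedModType R) :
  continuous (fst : R * E -> R).
Proof. by move=> [a b]; exact: (@cvg_fst _ _ (nbhs a) (nbhs b) _). Qed.

Lemma continuous_snd (R : realType) (E : normedModType R) :
  continuous (snd : R * E -> E).
Proof. by move=> [a b]; exact: (@cvg_snd _ _ (nbhs a) (nbhs b) _). Qed.

Lemma symmetric_bilinear0l {R : realType} {V : normedModType R}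
    {b : V -> V -> R} (u : V) : symmetric_bilinear b -> b 0 u = 0.
Proof.
move=> [_ bl]; have := bl 1 0 0 u.
by rewrite scale1r addr0 mul1r -[LHS]addr0 => /addrI.
Qed.

(** Expanding [b] in the standard basis gives a finite sum of products of coordinate functions with
    constant coefficients, to which the Leibniz rule applies term by term. *)
Lemma is_derive_bilinear {R : realType} {V : normedModType R} {n : nat}
    {b : 'rV[R]_n.+1 -> 'rV[R]_n.+1 -> R} {U W : V -> 'rV[R]_n.+1} {x v : V}
    {dU dW : 'rV[R]_n.+1} :
  symmetric_bilinear b -> is_derive x v U dU -> is_derive x v W dW ->
  is_derive x v (fun y => b (U y) (W y)) (b dU (W x) + b (U x) dW).
Proof.
move=> bb dUx dWx; have [bC bl] := bb.
have bsum u (a : 'I_n.+1 -> R) (e : 'I_n.+1 -> 'rV[R]_n.+1) :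
    b (\sum_i a i *: e i) u = \sum_i a i * b (e i) u.
  pose P (s : 'rV[R]_n.+1) (r : R) := b s u = r.
  by apply: (big_rec2 P) => [|i y1 y2 _ <-]; rewrite /P ?symmetric_bilinear0l // bl.
have bE u w : b u w = \sum_i \sum_j (u 0 i * w 0 j) * b (delta_mx 0 i) (delta_mx 0 j).
  rewrite {1}(row_sum_delta u) bsum; apply: eq_bigr => i _.
  rewrite bC {1}(row_sum_delta w) bsum mulr_sumr; apply: eq_bigr => j _.
  by rewrite bC mulrA.
have lc (i : 'I_n.+1) : linear (fun u : 'rV[R]_n.+1 => u 0 i).
  by move=> a u w; rewrite !mxE.
have -> : (fun y => b (U y) (W y)) =
   \sum_i \sum_j (fun y => U y 0 i * W y 0 j * b (delta_mx 0 i) (delta_mx 0 j)).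
  apply/funext => y; rewrite bE fct_sumE; apply: eq_bigr => i _.
  by rewrite fct_sumE.
rewrite !bE -big_split /=.
apply: is_derive_sum => i; rewrite -big_split /=.
apply: is_derive_sum => j.
have dUi := is_derive_linear (lc i) (@coord_continuous _ _ _ 0 i) dUx.
have dWj := is_derive_linear (lc j) (@coord_continuous _ _ _ 0 j) dWx.
set c := b _ _.
apply: is_derive_eq; rewrite /= !scaler0 add0r /GRing.scale /=; ring.
Qed.

(** * The Lie derivative of the metric along h d/dt *)

Lemma lie_bracket_pair0 (R : realType) (E : normedModType R) (h : R -> R)
    (X : R * E -> R * E) (x : R * E) :
  derivable h x.1 1 ->
  lie_bracket (fun y => (h y.1, 0)) X x =
  'D_(h x.1, 0) X x - ((X x).1 * 'D_1 h x.1, 0).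
Proof.
move=> dh; rewrite /lie_bracket; congr (_ - _).
have := is_derive_linear (@linear_pair0 R E) (@continuous_pair0 R E)
  (is_derive_fst (X x) dh).
by case.
Qed.

(** The derivatives of [X] and [Y] produced by the Leibniz rule cancel those in the brackets. What
    survives is the derivative of [sigma ^+ 2] and the terms in h' from the brackets. *)
Lemma lie_derivative_timelike (R : realType) (n : nat) (M : atlas 'rV[R]_n.+1)
    (g : tensor2 M) (I : set R) (f : points M -> R) (sigma h : R -> R)
    (i : chart M) (X Y : R * 'rV[R]_n.+1 -> R * 'rV[R]_n.+1) (x : R * 'rV[R]_n.+1) :
  symmetric_bilinear (g i x.2) ->
  derivable h x.1 1 -> derivable sigma x.1 1 ->
  differentiable X x -> differentiable Y x ->
  lie_derivative (timelike_vfield (I := I) (M := M) h i)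
    (doubly_warped_metric (I := I) f sigma g i) X Y x =
  - (f (param i x.2) ^+ 2) * (2 * 'D_1 h x.1 * ((X x).1 * (Y x).1)) +
  2 * sigma x.1 * 'D_1 sigma x.1 * h x.1 * g i x.2 (X x).2 (Y x).2.
Proof.
move=> bg dh ds dX dY.
(* Here [a] is -f^2; [p], [q] are the t-components of X, Y and [p'], [q'] their derivatives along h
   d/dt; [b] is g(X, Y), while [b1], [b2] have X, resp. Y, differentiated; [c], [dc] stand for
   sigma, sigma' and [e], [de] for h, h'. *)
have alg (a p q p' q' b b1 b2 c dc e de : R) :
    a * (p * q' + q * p') + (c ^+ 2 * (b1 + b2) + b * (2 * c ^+ 1 * (e * dc))) -
    (a * ((p' - p * de) * q) + c ^+ 2 * (b1 - 0)) -
    (a * (p * (q' - q * de)) + c ^+ 2 * (b2 - 0)) =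
    a * (2 * de * (p * q)) + 2 * c * dc * e * b by ring.
rewrite /lie_derivative /timelike_vfield !lie_bracket_pair0 //=.
set v := (h x.1, 0).
have DX := derivableP (diff_derivable (v := v) dX).
have DY := derivableP (diff_derivable (v := v) dY).
have DX1 := is_derive_linear (@linear_fst R _) (@continuous_fst R _) DX.
have DY1 := is_derive_linear (@linear_fst R _) (@continuous_fst R _) DY.
have DX2 := is_derive_linear (@linear_snd R _) (@continuous_snd R _) DX.
have DY2 := is_derive_linear (@linear_snd R _) (@continuous_snd R _) DY.
have Ds := is_derive_fst v ds.
have Dg := is_derive_bilinear bg DX2 DY2.
set a := - (f (param i x.2) ^+ 2).
(* G agrees on the line x + R v with the function to be differentiated, but its
   only coefficient not frozen at x is sigma, so that g and f need not be
   differentiated. *)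
pose G := a *: ((fst \o X) * (fst \o Y)) +
  (sigma \o fst) ^+ 2 * (fun y => g i x.2 (X y).2 (Y y).2).
have -> : 'D_v (fun y => doubly_warped_metric (I := I) f sigma g i y (X y) (Y y)) x = 'D_v G x.
  rewrite /derive; set p := fun _ : R => _; set q := fun _ : R => _.
  suff -> : p = q by []; apply/funext => t; rewrite /p /q /=.
  by rewrite /doubly_warped_metric /G /= scaler0 add0r.
have -> := derive_val (is_derive :=
  is_deriveD (is_deriveZ a (is_deriveM DX1 DY1)) (is_deriveM (is_deriveX 2 Ds) Dg)).
have [bC bl] := bg.
have bB u u' w : g i x.2 (u - u') w = g i x.2 u w - g i x.2 u' w.
  by rewrite addrC -scaleN1r bl mulN1r addrC.
have b0 w : g i x.2 0 w = 0 by exact: symmetric_bilinear0l.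
rewrite /doubly_warped_metric -/a /= !bB !(bC (X x).2 (_ - _)) !bB !b0.
rewrite -[((sigma \o fst) ^+ 2) x]/(sigma x.1 ^+ 2) (bC (X x).2 ('D_v Y x).2).
exact: alg.
Qed.

(** * Smoothness of h d/dt on the product *)

Lemma open_setX {R : realType} {E : normedModType R} {I : set R} {U : set E} :
  open I -> open U -> open (I `*` U).
Proof.
move=> oI oU; have -> : I `*` U = fst @^-1` I `&` snd @^-1` U by [].
apply: openI; apply: open_comp => // y _; first exact: continuous_fst.
exact: continuous_snd.
Qed.

(** The derivative of (h(t), 0) along [v] is (v.1 h'(t), 0), which has the same shape with
    ['D_(v.1) h] for [h]; hence the induction over all [h]. *)
Lemma Ck_on_pair0 (R : realType) (E : normedModType R) (k : nat) (I : set R)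
    (U : set E) (h : R -> R) :
  open I -> open U -> Ck_on k I h ->
  Ck_on k (I `*` U) (fun x : R * E => (h x.1, 0 : E)).
Proof.
move=> oI oU; elim: k h => [|k IHk] h.
  move=> hc x [Ix _]; apply: (@continuous_comp _ _ _ (h \o fst) (fun r => (r, 0)));
    last exact: continuous_pair0.
  apply: (@continuous_comp _ _ _ fst h); last exact: hc.
  by case: x {Ix} => a b; exact: (@cvg_fst _ _ (nbhs a) (nbhs b) _).
move=> [hd hD]; split=> [x [Ix _]|v].
  apply: differentiable_pair; last exact: differentiable_cst.
  have [dfst _] := is_diff_linear x (@linear_fst R E) (continuous_fst R E).
  exact: (@differentiable_comp _ _ _ _ fst h x dfst (hd _ Ix)).
apply: (eq_Ck_on (f := fun x : R * E => ('D_(v.1) h x.1, 0 : E))).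
- exact: open_setX.
- move=> x [Ix _]; have dh : derivable h x.1 1 by apply/derivable1_diffP/hd.
  have hE : 'D_(v.1) h x.1 = v.1 *: 'D_1 h x.1 := @derive_val _ _ _ _ _ _ _ (is_derive_fst v dh).
  rewrite hE; apply/esym.
  exact: (@derive_val _ _ _ _ _ _ _ (is_derive_linear (@linear_pair0 R E)
    (@continuous_pair0 R E) (is_derive_fst v dh))).
- exact: (IHk _ (hD v.1)).
Qed.

Lemma smooth_vfield_timelike (R : realType) (E : normedModType R) (M : atlas E)
    (I : set R) (h : R -> R) :
  smooth_manifold M -> open I -> smooth_on I h ->
  smooth_vfield (timelike_vfield (I := I) (M := M) h).
Proof.
move=> [_ _ _ hM tM] oI hI; split=> [i k|i j x [[Ix Ux] [_ Vx]]].
  by have [_ oU _ _ _] := hM i; exact: Ck_on_pair0.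
have dt : differentiable (transition (M := M) i j) x.2.
  by have [+ _] := tM i j 1%N; apply; split.
have dfst := is_diff_linear x (@linear_fst R E) (continuous_fst R E).
have dsnd := is_diff_linear x (@linear_snd R E) (continuous_snd R E).
have dts := is_diff_comp dsnd (differentiableP dt).
(* A transition of the product is id times a transition of M, so its differential is id times a
   linear map and fixes (h, 0). *)
rewrite -[transition i j]/(fun y : R * E => (y.1, (transition (M := M) i j \o snd) y)).
have [_ ->] := is_diff_pair dfst dts.
by rewrite /timelike_vfield /= linear0.
Qed.

(** The quotient h / s has derivative (h' s - h s') / s^2 = 0. Connectedness keeps the segment
    between two points inside [I], where the mean value theorem makes the quotient constant. *)
Lemma Wronskian0_proportional (R : realType) (I : set R) (h s : R -> R) :
  connected I -> I !=set0 ->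
  (forall t, I t -> derivable h t 1) -> (forall t, I t -> derivable s t 1) ->
  (forall t, I t -> s t != 0) ->
  (forall t, I t -> h t * 'D_1 s t = 'D_1 h t * s t) ->
  exists a, forall t, I t -> h t = a * s t.
Proof.
move=> /connected_intervalP cI [t0 It0] dh ds s0 hs.
have dq t : I t -> is_derive t 1 (h * (fun t => (s t)^-1)) 0.
  move=> It; have Dh := derivableP (dh t It).
  have Ds := derivableP (ds t It).
  have DV : is_derive t 1 (fun t => (s t)^-1) (- (s t) ^- 2 *: 'D_1 s t).
    by apply: DeriveDef; [exact: derivableV (s0 t It) (ds t It)|exact: deriveV (s0 t It) (ds t It)].
  apply: is_derive_eq; rewrite /GRing.scale /=.
  have st := s0 t It.
  have -> : 'D_1 h t = h t * 'D_1 s t / s t by rewrite hs // mulfK.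
  by field.
have qE a b : a <= b -> I a -> I b -> h a / s a = h b / s b.
  move=> ab Ia Ib.
  have Iab t : t \in `[a, b] -> I t.
    by rewrite in_itv /= => abt; apply: cI Ia Ib _ abt.
  have [| |c _] := MVT_segment (f := h * (fun t => (s t)^-1)) (df := fun=> 0) ab.
  - by move=> t tab; apply/dq/Iab; apply: subset_itv_oo_cc tab.
  - apply: derivable_within_continuous => t /Iab /dq; by case.
  - by rewrite mul0r => /eqP; rewrite subr_eq0 => /eqP.
exists (h t0 / s t0) => t It.
suff -> : h t0 / s t0 = h t / s t by rewrite divfK // s0.
by case: (leP t t0) => [/qE|/ltW/qE] ->.
Qed.

(** * The characterisation of conformal fields h d/dt *)

Theorem theorem8 (R : realType) (n : nat) (M : atlas 'rV[R]_n.+1)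
    (g : tensor2 M) (I : set R) (f : points M -> R) (sigma h : R -> R)
    (smooth_M : smooth_manifold M) (M_neq0 : carrier M !=set0)
    (riem_g : riemannian_metric g)
    (open_I : open I) (connected_I : connected I) (I_neq0 : I !=set0)
    (smooth_f : smooth_fun f) (f_gt0 : forall p, carrier M p -> 0 < f p)
    (smooth_sigma : smooth_on I sigma)
    (sigma_gt0 : forall t, I t -> 0 < sigma t)
    (smooth_h : smooth_on I h) :
  let conformal :=
    conformal_vfield (doubly_warped_metric (I := I) f sigma g)
                     (timelike_vfield (I := I) (M := M) h) in
  [/\ (exists rho, conformal rho) <->
        (exists a : R, forall t, I t -> h t = a * sigma t),
      (forall t, I t -> 0 <= h t) ->
        ((exists rho, conformal rho) <->
         (exists a : R, 0 <= a /\ forall t, I t -> h t = a * sigma t)) &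
      forall rho, conformal rho ->
        forall t p, I t -> carrier M p -> rho (t, p) = 2 * derive1 h t].
Proof.
move=> conformal; have [_ _ cM hM _] := smooth_M.
have dh t : I t -> derivable h t 1.
  by move=> It; apply/derivable1_diffP; have [+ _] := smooth_h 1%N; apply.
have ds t : I t -> derivable sigma t 1.
  by move=> It; apply/derivable1_diffP; have [+ _] := smooth_sigma 1%N; apply.
have [[bg _ _] g_gt0] := riem_g.
have lieE (i : chart M) X Y (x : R * 'rV[R]_n.+1) :
    smooth_on (I `*` cod i) X -> smooth_on (I `*` cod i) Y ->
    (I `*` cod i) x ->
    lie_derivative (timelike_vfield (I := I) (M := M) h i)
      (doubly_warped_metric (I := I) f sigma g i) X Y x =
    - (f (param i x.2) ^+ 2) * (2 * 'D_1 h x.1 * ((X x).1 * (Y x).1)) +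
    2 * sigma x.1 * 'D_1 sigma x.1 * h x.1 * g i x.2 (X x).2 (Y x).2.
  move=> sX sY [Ix Ux]; apply: lie_derivative_timelike.
  - exact: bg.
  - exact: dh.
  - exact: ds.
  - by have [+ _] := sX 1%N; apply; split.
  - by have [+ _] := sY 1%N; apply; split.
have nec rho t p : conformal rho -> I t -> carrier M p ->
    rho (t, p) = 2 * 'D_1 h t /\ h t * 'D_1 sigma t = 'D_1 h t * sigma t.
  move=> [_ crho] It Mp.
  have [i _ ip] : (\bigcup_(i in [set: chart M]) dom i) p by rewrite -cM.
  have [_ _ /(_ p ip)[Up pK] _ _] := hM i.
  pose x := (t, Defs.coord i p).
  have Ix : (I `*` cod i) x by [].
  (* Constant fields X = Y = u in one chart around [p] turn the conformal equation into an equality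
     of quadratic forms in [u]. *)
  have tst (u : R * 'rV[R]_n.+1) :
      - (f p ^+ 2) * (2 * 'D_1 h t * (u.1 * u.1)) +
      2 * sigma t * 'D_1 sigma t * h t * g i (Defs.coord i p) u.2 u.2 =
      rho (t, p) * (- (f p ^+ 2) * (u.1 * u.1) + sigma t ^+ 2 * g i (Defs.coord i p) u.2 u.2).
    have su : smooth_on (I `*` cod i) (cst u) by move=> k; exact: Ck_on_cst.
    have := crho i (cst u) (cst u) su su x Ix.
    rewrite lieE // /= /doubly_warped_metric /x /= pK => <- //.
  have bgp := bg i _ Up.
  have rhoE : rho (t, p) = 2 * 'D_1 h t.
    have := tst (1, 0); rewrite /= symmetric_bilinear0l // !mulr0 !addr0 !mulr1 mulrC.
    by move/mulIf => -> //; rewrite oppr_eq0 expf_neq0 // gt_eqF // f_gt0.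
  split=> //.
  (* Any nonzero tangent vector of M would do; one exists since the dimension [n.+1] is positive. *)
  pose u : 'rV[R]_n.+1 := const_mx 1.
  have u0 : u != 0.
    by apply/eqP => /matrixP/(_ 0 0); rewrite !mxE => /eqP; rewrite oner_eq0.
  have gu := g_gt0 _ _ Up u u0.
  have := tst (0, u); rewrite /= rhoE !mulr0 !add0r.
  (* With rho = 2 h', both sides of the equation at (0, u) carry this nonzero factor; cancelling it
     leaves h sigma' = h' sigma. *)
  have c0 : 2 * sigma t * g i (Defs.coord i p) u u != 0.
    by rewrite !mulf_neq0 ?pnatr_eq0 // gt_eqF // sigma_gt0.
  move=> e; apply: (mulfI c0).
  transitivity (2 * sigma t * 'D_1 sigma t * h t * g i (Defs.coord i p) u u); first by ring.
  by rewrite e; ring.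
(* For the converse, h' = a sigma' gives h sigma' = h' sigma, so both parts of the Lie derivative
   are 2 h' times those of the metric, whatever the sign of [a]. *)
have suf a : (forall t, I t -> h t = a * sigma t) ->
    conformal (fun q => 2 * 'D_1 h q.1).
  move=> hE; split; first exact: smooth_vfield_timelike.
  move=> i X Y sX sY x [Ix Ux]; rewrite lieE // /doubly_warped_metric /=.
  have -> : 'D_1 h x.1 = a * 'D_1 sigma x.1.
    have <- : 'D_1 (a *: sigma) x.1 = a * 'D_1 sigma x.1 by rewrite deriveZ //; exact: ds.
    (* The relation h = a sigma is known only on [I], but [I] is open, so it holds near each of its
       points and can be differentiated. *)
    by apply: near_eq_derive; apply: filterS (open_nbhs_nbhs (conj open_I Ix)).
  by rewrite hE //; ring.
have fwd : (exists rho, conformal rho) ->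
    exists a, forall t, I t -> h t = a * sigma t.
  (* Fixing one point [p] of M leaves an ordinary differential relation in t on [I]. *)
  move=> [rho crho]; have [p Mp] := M_neq0.
  apply: (Wronskian0_proportional R I) => // t It; first by rewrite gt_eqF // sigma_gt0.
  by have [] := nec rho t p crho It Mp.
split.
- by split=> // -[a /suf]; exists (fun q => 2 * 'D_1 h q.1).
(* The field -sigma d/dt is conformal too, with a = -1, so the sign of [a] must come from that of
   [h]; as sigma > 0, a single t decides it. *)
- move=> h_ge0; split=> [/fwd[a hE]|[a [_ /suf]]]; last by exists (fun q => 2 * 'D_1 h q.1).
  exists a; split=> //; have [t It] := I_neq0.
  by rewrite -(pmulr_lge0 _ (sigma_gt0 t It)) -hE // h_ge0.
- by move=> rho crho t p It Mp; have [-> _] := nec rho t p crho It Mp; rewrite derive1E.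
Qed.
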